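(* Let $\alpha\in(0,1)$, $\gamma>0$, $p\in(0,\alpha)$, let $M,N\ge 1$ be integers, $k\in\{1,\dots,N\}$, $\delta\in(0,1)$ and $\eta\in(0,1)$. Let $\Omega\in\mathbb{R}^{M\times N}$ be a random matrix whose entries $\omega_{ij}$ are i.i.d. symmetric $\alpha$-stable random variables with distribution $S\alpha S(\gamma)$. Let $C_{\mathrm{net}}=2(2^{1/\alpha-1})^2+2^{1/\alpha-1}$, and let $C_{\mathrm{con}}=C_{\mathrm{con}}(\alpha,p,\gamma)$ and $c_{\mathrm{con}}=c_0\left(\frac{\alpha}{p}-1\right)$, with $0<c_0<1/2$, be concentration constants for $(\alpha,p,\gamma)$ (as defined in the context). If $$M \geq \left( \frac{2 C_{\mathrm{con}}}{\eta}\, C_{\mathrm{net}}^k \left(\frac{3}{\delta}\right)^{k/p} \left(\frac{eN}{k}\right)^k \right)^{1/c_{\mathrm{con}}},$$ then, with probability at least $1-\eta$, $\Omega$ satisfies the $(\delta,k)$-RQIP (with the given $\alpha,\gamma,p$); that is, with probability at least $1-\eta$, for all $k$-sparse vectors $x\in\mathbb{R}^N$, $$(1-\delta)\, C_{\alpha,p}\, (\gamma \|x\|_\alpha)^p \le \frac{1}{M}\sum_{i=1}^M |\omega_i^T x|^p \le (1+\delta)\, C_{\alpha,p}\, (\gamma\|x\|_\alpha)^p .$$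
   Context: Symmetric stable law: $S\alpha S(\gamma)$ is the symmetric $\alpha$-stable distribution with scale parameter $\gamma>0$, i.e. with characteristic function $t\mapsto \exp(-\gamma^\alpha|t|^\alpha)$. Notation: for $x\in\mathbb{R}^N$, $\|x\|_\alpha=\left(\sum_{j=1}^N|x_j|^\alpha\right)^{1/\alpha}$; $x$ is $k$-sparse if it has at most $k$ non-zero entries. $\omega_i^T$ denotes the $i$-th row of $\Omega$. For $p\in(0,\alpha)$, $C_{\alpha,p}>0$ is the constant, depending only on $\alpha$ and $p$, such that $\mathbb{E}[|Y|^p]=C_{\alpha,p}\sigma^p$ whenever $Y\sim S\alpha S(\sigma)$, $\sigma>0$. RQIP (Restricted Quasiconvexity Isometry Property): given $\alpha\in(0,1)$ and $\gamma>0$, a matrix $\Omega\in\mathbb{R}^{M\times N}$ satisfies the $(\delta,k)$-RQIP for some $\delta\in(0,1)$ if, for some $p\in(0,\alpha)$, there is a constant $C_{\alpha,p}>0$ (depending on $\alpha$ and $p$) such that for all $k$-sparse $x\in\mathbb{R}^N$, $(1-\delta)C_{\alpha,p}(\gamma\|x\|_\alpha)^p\le\frac1M\sum_{i=1}^M|\omega_i^Tx|^p\le(1+\delta)C_{\alpha,p}(\gamma\|x\|_\alpha)^p$. Concentration constants: $C_{\mathrm{con}}=C_{\mathrm{con}}(\alpha,p,\gamma)$ and $c_{\mathrm{con}}=c_0(\alpha/p-1)$, with $0<c_0<1/2$, are constants with the following property: for every $\varepsilon>0$ there exists $M_0=M_0(\varepsilon,\alpha,p,\gamma)>0$ such that for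 every integer $m>M_0$ and i.i.d. $X_1,\dots,X_m\sim S\alpha S(\gamma)$, $$\mathbb{P}\left(\left|\frac1m\sum_{i=1}^m|X_i|^p-\mathbb{E}[|X_1|^p]\right|>\varepsilon\right)\le C_{\mathrm{con}}\, m^{-c_{\mathrm{con}}}.$$
   Formalization: The formal theorem also assumes M > M_0(ε) at ε = (δ/3)·C_{α,p}γ^p, the threshold of the concentration inequality; without it the claim fails, since any C_con > 0 is then a valid concentration constant (take M = N = k = 1 and C_con tiny). *)

(* Defs.v *)
From HB Require Import structures.
From mathcomp Require Import all_boot all_order all_algebra.
From mathcomp Require Import complex.
From mathcomp Require Import all_classical all_reals all_analysis.

Set Implicit Arguments.
Unset Strict Implicit.
Unset Printing Implicit Defensive.

Import Order.TTheory GRing.Theory Num.Theory.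
Import numFieldNormedType.Exports.

Local Open Scope classical_set_scope.
Local Open Scope ring_scope.

Section Probability.
Context {d : measure_display} {T : measurableType d} {R : realType}.
Variable P : probability T R.

(* E[exp(i t X)], split into real and imaginary parts because the library
   integrates real-valued functions only. *)
Definition char_fun (X : T -> R) (t : R) : R[i]%C :=
  Complex (\int[P]_w cos (t * X w))%R (\int[P]_w sin (t * X w))%R.

Definition sym_stable (alpha sigma : R) (X : T -> R) : Prop :=
  forall t : R,
    char_fun X t = Complex (expR (- (sigma `^ alpha * `|t| `^ alpha))) 0.

Definition mutually_independent (I : finType) (X : I -> {RV P >-> R}) : Prop :=
  forall (J : {set I}) (B : I -> set R),
    (forall i, measurable (B i)) ->
    P [set w | forall i, i \in J -> B i (X i w)] =
    (\prod_(i in J) P (X i @^-1` B i))%E.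

(* The common law is determined by its characteristic function, so
   "identically distributed" needs no separate clause. *)
Definition iid_sym_stable (alpha sigma : R) (I : finType)
    (X : I -> {RV P >-> R}) : Prop :=
  mutually_independent X /\ forall i, sym_stable alpha sigma (X i).

End Probability.

Section Stable.
Context {R : realType}.

(* C is C_{alpha,p}. *)
Definition stable_moment_constant (alpha p C : R) : Prop :=
  0 < C /\
  forall (d : measure_display) (T : measurableType d) (P : probability T R)
         (Y : {RV P >-> R}) (sigma : R),
    0 < sigma -> sym_stable P alpha sigma Y ->
    ('E_P[fun w => (`|Y w| `^ p)%R])%E = (C * sigma `^ p)%:E.

(* The sample size is n.+1; X ord0 plays the role of X_1. *)
Definition concentration_property (alpha p gamma Ccon ccon : R)
    (M0 : R -> R) : Prop :=
  forall eps : R, 0 < eps ->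
    0 < M0 eps /\
    forall (d : measure_display) (T : measurableType d) (P : probability T R)
           (n : nat) (X : 'I_n.+1 -> {RV P >-> R}),
      M0 eps < n.+1%:R -> iid_sym_stable alpha gamma X ->
      (P [set w | eps < `| n.+1%:R^-1 * (\sum_(i < n.+1) `|X i w| `^ p)
                           - fine 'E_P[fun v => (`|X ord0 v| `^ p)%R] |]%R
       <= (Ccon * n.+1%:R `^ (- ccon))%:E)%E.

End Stable.

Section RQIP.
Context {R : realType}.

Definition quasinorm (alpha : R) (N : nat) (x : 'cV[R]_N) : R :=
  (\sum_(j < N) `|x j ord0| `^ alpha) `^ alpha^-1.

Definition sparse (k N : nat) (x : 'cV[R]_N) : bool :=
  (#|[set j : 'I_N | x j ord0 != 0%R]%SET| <= k)%N.

(* The (delta, k)-RQIP for a given exponent p and constant C. *)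
Definition RQIP_with (alpha gamma p C delta : R) (k M N : nat)
    (Omega : 'M[R]_(M, N)) : Prop :=
  forall x : 'cV[R]_N, sparse k x ->
    (1 - delta) * C * (gamma * quasinorm alpha x) `^ p
      <= M%:R^-1 * (\sum_(i < M) `|(Omega *m x) i ord0| `^ p)
      <= (1 + delta) * C * (gamma * quasinorm alpha x) `^ p.

Definition Cnet (alpha : R) : R :=
  2 * (2 `^ (alpha^-1 - 1)) ^+ 2 + 2 `^ (alpha^-1 - 1).

End RQIP.

(* Main.v *)
Require Import Defs.
From HB Require Import structures.
From mathcomp Require Import all_boot all_order all_algebra.
From mathcomp Require Import complex.
From mathcomp Require Import all_classical all_reals all_analysis.
From mathcomp Require Import measurable_realfun.
From mathcomp Require Import ring lra.

(** Fix a vector [x] with [||x||_alpha = 1].  By stability the coordinates of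
    [Omega x] are i.i.d. with the same law as the entries ([iid_row_sum]), so the
    concentration hypothesis applies to [(1/M) sum_i |omega_i^T x|^p] and shows
    that it is within [delta / 3] (relatively) of its mean
    [A = C_{alpha,p} gamma^p], outside an event of probability at most
    [Ccon * M^(- ccon)].  It remains to make this uniform in [x].

    For a fixed matrix, [f x = (1/M) sum_i |omega_i^T x|^p] is subadditive because
    [p < 1], and homogeneous of degree [p].  If it is close to [A] on a net of the
    sphere of a [k]-dimensional coordinate subspace, of radius
    [(delta / 3)^(1/p)], then comparing a point with its net neighbour controls
    the supremum of [f] on the sphere and then its values
    ([net_concentration]).  By homogeneity this is the RQIP on that subspace, and
    the sparse vectors are covered by the ['C(N, k) <= (e N / k)^k] subspaces.

    The nets have at most [Cnet^k (3 / delta)^(k/p)] points.  The usual argument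
    compares volumes of balls; here [packing_bound] derives the same bound from
    counting, by iterating a separated set at smaller and smaller scales.  A
    union bound over all net points then gives failure probability at most
    [eta / 2] under the assumption on [M].

    On the probabilistic side, a row sum is built by adding two independent
    variables at a time ([mutually_independent_merge], [stable_law_add]); both
    facts come from the law of an independent pair being a product measure.
    Measurability of the RQIP event holds because rational sparse vectors are
    dense among sparse ones ([rational_pseminorm_le]). *)

Set Implicit Arguments.
Unset Strict Implicit.
Unset Printing Implicit Defensive.

Import Order.TTheory GRing.Theory Num.Theory.
Import numFieldNormedType.Exports.

Local Open Scope classical_set_scope.
Local Open Scope ring_scope.

(** * Subadditivity of real powers *)

Section PowerFunction.
Context {R : realType}.
Implicit Types a b p x y : R.

(** Both summands are at most [s = a + b], and [t <= t `^ p] on [0, 1]: hence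
    [1 = a / s + b / s <= (a / s) `^ p + (b / s) `^ p]. *)
Lemma powR_subadd p a b : 0 < p <= 1 -> 0 <= a -> 0 <= b ->
  (a + b) `^ p <= a `^ p + b `^ p.
Proof.
move=> /andP[p0 p1] a0 b0.
have [s0|] := ltP 0 (a + b); last first.
  move=> s0.
  have -> : a = 0 by lra.
  have -> : b = 0 by lra.
  by rewrite addr0 lerDl powR_ge0.
have step c : 0 <= c -> c <= a + b -> (a + b) `^ p * (c / (a + b)) <= c `^ p.
  move=> c0 cs; have [->|cn0] := eqVneq c 0.
    by rewrite mul0r mulr0 powR_ge0.
  have cp : 0 < c by rewrite lt_def cn0.
  have q0 : 0 < c / (a + b) <= 1 by rewrite divr_gt0//= ler_pdivrMr// mul1r.
  rewrite -[leRHS](_ : (a + b) `^ p * (c / (a + b)) `^ p = _); last first.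
    by rewrite -powRM// ?divr_ge0 ?(ltW s0)// mulrC divfK// gt_eqF.
  by rewrite ler_wpM2l ?powR_ge0//; exact: ger1_powR.
apply: le_trans (lerD (step a a0 _) (step b b0 _)); [|lra|lra].
by rewrite -mulrDr -mulrDl divff ?mulr1// gt_eqF.
Qed.

Lemma le_powR p x y : 0 <= p -> 0 <= x -> x <= y -> x `^ p <= y `^ p.
Proof.
move=> p0 x0 xy; apply: ge0_ler_powR => //; rewrite nnegrE//.
exact: le_trans xy.
Qed.

Lemma powRVK p x : p != 0 -> 0 <= x -> (x `^ p^-1) `^ p = x.
Proof. by move=> p0 x0; rewrite -powRrM mulVf// powRr1. Qed.

Lemma powRKV p x : p != 0 -> 0 <= x -> (x `^ p) `^ p^-1 = x.
Proof. by move=> p0 x0; rewrite -powRrM divff// powRr1. Qed.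

Lemma powR_invr p x : 0 <= x -> x^-1 `^ p = (x `^ p)^-1.
Proof. by move=> x0; rewrite -powR_inv1// -powRrM mulN1r powRN. Qed.

Lemma powRXn p x n : 0 <= x -> (x ^+ n) `^ p = (x `^ p) ^+ n.
Proof.
move=> x0; elim: n => [|n ih]; first by rewrite !expr0 powR1.
by rewrite !exprS powRM// ?exprn_ge0// ih.
Qed.

End PowerFunction.

(** * p-seminorms *)

Section Pseminorm.
Context {R : realType} {V : lmodType R}.
Implicit Types (f g : V -> R) (p : R) (x y : V).

(** The three quantities compared in the proof, namely the power sum
    [sum_j |x_j|^alpha], the power [||x||_alpha^p] of the quasinorm and the
    empirical moment of order [p] of a fixed matrix, are all of this kind.  They
    are subadditive themselves, whereas the quasinorm only satisfies a triangle
    inequality with a constant; this is why powers of norms are used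
    throughout. *)
Definition pseminorm p f :=
  [/\ forall x, 0 <= f x, forall x y, f (x + y) <= f x + f y &
      forall c x, f (c *: x) = `|c| `^ p * f x].

Lemma pseminorm0 p f : p != 0 -> pseminorm p f -> f 0 = 0.
Proof.
by move=> p0 [_ _ h]; rewrite -(scale0r 0) h normr0 powR0// mul0r.
Qed.

Lemma pseminormN p f x : pseminorm p f -> f (- x) = f x.
Proof. by move=> [_ _ h]; rewrite -scaleN1r h normrN1 powR1 mul1r. Qed.

Lemma pseminorm_distC p f x y : pseminorm p f -> f (x - y) = f (y - x).
Proof. by move=> hf; rewrite -(pseminormN _ hf) opprB. Qed.

(** The reverse triangle inequality: a p-seminorm is controlled at [x] by its
    value at a nearby [y]. *)
Lemma pseminorm_leD p f x y : pseminorm p f -> f x <= f y + f (x - y).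
Proof. by move=> [_ h _]; rewrite -{1}(subrK y x) addrC; exact: h. Qed.

Lemma pseminormZ p (C : R) f : 0 <= C -> pseminorm p f ->
  pseminorm p (fun x => C * f x).
Proof.
move=> C0 [h0 hD hZ]; split=> [x|x y|c x]; first by rewrite mulr_ge0.
- by rewrite -mulrDr ler_wpM2l.
- by rewrite hZ mulrCA.
Qed.

Lemma pseminorm_sum p (I : finType) (F : I -> V -> R) :
  (forall i, pseminorm p (F i)) -> pseminorm p (fun x => \sum_i F i x).
Proof.
move=> hF; split=> [x|x y|c x].
- by apply: sumr_ge0 => i _; case: (hF i).
- by rewrite -big_split/=; apply: ler_sum => i _; case: (hF i).
- by rewrite mulr_sumr; apply: eq_bigr => i _; case: (hF i).
Qed.

Lemma pseminorm_linear p (l : V -> R) : 0 < p <= 1 ->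
  (forall x y, l (x + y) = l x + l y) -> (forall c x, l (c *: x) = c * l x) ->
  pseminorm p (fun x => `|l x| `^ p).
Proof.
move=> hp lD lZ; split=> [x|x y|c x]; first exact: powR_ge0.
- rewrite lD; apply: le_trans (powR_subadd hp (normr_ge0 _) (normr_ge0 _)).
  by case/andP: hp => /ltW p0 _; apply: le_powR; rewrite ?ler_normD.
- by rewrite lZ normrM powRM.
Qed.

Lemma pseminorm_powR p r f : 0 < r <= 1 -> pseminorm p f ->
  pseminorm (p * r) (fun x => f x `^ r).
Proof.
move=> hr [h0 hD hZ]; split=> [x|x y|c x]; first exact: powR_ge0.
- apply: le_trans (powR_subadd hr (h0 _) (h0 _)).
  by case/andP: hr => /ltW r0 _; apply: le_powR.
- by rewrite hZ powRM// ?powR_ge0// powRrM.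
Qed.

Lemma le_pseminorm_sum p f (I : Type) (s : seq I) (F : I -> V) : p != 0 ->
  pseminorm p f -> f (\sum_(i <- s) F i) <= \sum_(i <- s) f (F i).
Proof.
move=> p0 hf; elim: s => [|i s ih]; first by rewrite !big_nil (pseminorm0 p0 hf).
rewrite !big_cons; case: (hf) => _ hD _.
by apply: le_trans (hD _ _) _; rewrite lerD2l.
Qed.

End Pseminorm.

(** * Power sums of coordinates *)

Section Coordinates.
Context {R : realType} {N : nat}.
Implicit Types (x y : 'cV[R]_N) (a p : R).

Definition power_sum a x : R := \sum_(j < N) `|x j ord0| `^ a.

Lemma power_sum_pseminorm a : 0 < a <= 1 -> pseminorm a (power_sum a).
Proof.
move=> ha; apply: (@pseminorm_sum _ _ a 'I_N) => j.
by apply: (pseminorm_linear ha) => [x y|c x]; rewrite mxE.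
Qed.

Lemma power_sum_ge a x j : `|x j ord0| `^ a <= power_sum a x.
Proof.
rewrite /power_sum (bigD1 j)//= lerDl sumr_ge0// => i _; exact: powR_ge0.
Qed.

Lemma power_sum_eq0 a x : power_sum a x = 0 -> x = 0.
Proof.
move=> x0; apply/matrixP => j l; rewrite ord1 mxE.
apply: normr0_eq0; apply: (@powR_eq0_eq0 _ _ a); apply: le_anti.
by rewrite powR_ge0 -x0 power_sum_ge.
Qed.

Lemma quasinorm_pseminorm a p : 0 < p <= a -> a <= 1 ->
  pseminorm p (fun x => quasinorm a x `^ p).
Proof.
move=> /andP[p0 pa] a1; have a0 : 0 < a by lra.
have -> : (fun x => quasinorm a x `^ p) = (fun x => power_sum a x `^ (p / a)).
  by apply/funext => x; rewrite /quasinorm -powRrM mulrC.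
have := @pseminorm_powR _ _ a (p / a) (power_sum a).
rewrite mulrCA divff ?gt_eqF// mulr1; apply.
  by rewrite divr_gt0//= ler_pdivrMr// mul1r.
by apply: power_sum_pseminorm; rewrite a0.
Qed.

(** Expanding [x] in the canonical basis bounds any p-seminorm by one that
    depends on the coordinates only; this gives boundedness on the sphere and
    continuity. *)
Lemma le_pseminorm_coord p (f : 'cV[R]_N -> R) x : p != 0 -> pseminorm p f ->
  f x <= \sum_(j < N) `|x j ord0| `^ p * f (delta_mx j ord0).
Proof.
move=> p0 hf; rewrite {1}(matrix_sum_delta x).
apply: le_trans (le_pseminorm_sum _ _ p0 hf) _.
apply: ler_sum => j _; rewrite big_ord1 ord1.
by case: hf => _ _ ->.
Qed.

End Coordinates.

(** * Packing and covering the sphere *)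

Section Addresses.
Context {R : realType} {V : lmodType R} {I : eqType}.
Context {a : R} {q : V -> R} (hq : pseminorm a q).
Context {y : I -> V} (hy : forall i, q (y i) <= 1).

(** The points of a self-similar set: the word [i0 i1 i2 ...] is sent to
    [y i0 + b y i1 + b^2 y i2 + ...]. *)
Fixpoint address (b : R) (w : seq I) : V :=
  if w is i :: w' then y i + b *: address b w' else 0.

(** [9 / 8] is the fixed point of [t |-> 1 + t / 9], the bound propagated from
    the tail of a word to the word. *)
Lemma address_le (a0 : a != 0) b w : `|b| `^ a <= 9^-1 ->
  q (address b w) <= 9 / 8.
Proof.
case: (hq) => q0 qD qZ hb; elim: w => [|i w ih] /=.
  by rewrite (pseminorm0 a0 hq); lra.
apply: le_trans (qD _ _) _; rewrite qZ.
have : `|b| `^ a * q (address b w) <= 9^-1 * (9 / 8).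
  by apply: ler_pM => //; exact: powR_ge0.
by have := hy i; lra.
Qed.

(** When the first letters differ, the two tails move the points by at most
    [(r / 3) (9 / 8 + 9 / 8) = 3 r / 4], so [r / 4] of the separation of the [y i]
    remains; a common first letter only rescales the problem by [b]. *)
Lemma address_separated (a0 : a != 0) b r w w' : 0 < r <= 3^-1 ->
  `|b| `^ a = r / 3 ->
  (forall i i', i != i' -> r < q (y i - y i')) ->
  size w = size w' -> w != w' ->
  (r / 3) ^+ size w * (r / 4) < q (address b w - address b w').
Proof.
case: (hq) => q0 qD qZ /andP[r0 r3] hb hsep.
have hb9 : `|b| `^ a <= 9^-1 by rewrite hb; lra.
elim: w w' => [|i w ih] [|i' w']//= [sw] nw.
have [ii'|ii'] := eqVneq i i'.
  have ww' : w != w' by apply: contra_neq nw => ->; rewrite ii'.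
  rewrite ii' opprD addrACA subrr add0r -scalerBr qZ hb exprS -mulrA.
  by rewrite ltr_pM2l ?ih//; lra.
have h1 : (r / 3) ^+ (size w).+1 * (r / 4) <= r / 4.
  by rewrite ler_piMl ?exprn_ile1//; lra.
apply: le_lt_trans h1 _.
set F := address b w; set F' := address b w'.
have h2 : q (y i - y i') <=
    q (y i + b *: F - (y i' + b *: F')) + (r / 3) * (9 / 8 + 9 / 8).
  have -> : y i - y i' = (y i + b *: F - (y i' + b *: F')) + b *: (F' - F).
    by rewrite scalerBr opprD [X in _ = X + _]addrACA -(opprB (b *: F)) addrK.
  apply: le_trans (qD _ _) _; rewrite lerD2l qZ hb ler_pM2l; last lra.
  apply: le_trans (qD _ _) _; rewrite (pseminormN _ hq).
  by apply: lerD; exact: address_le.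
by have := hsep _ _ ii'; lra.
Qed.

End Addresses.

Section Packing.
Context {R : realType} {N : nat}.
Implicit Types (a r : R) (S : {set 'I_N}) (x y : 'cV[R]_N).

Definition supported S x := forall j, j \notin S -> x j ord0 = 0.

Lemma bounded_powers_le1 (z K : R) : 0 <= z -> (forall n, z ^+ n <= K) -> z <= 1.
Proof.
move=> z0 hz; rewrite leNgt; apply/negP => z1.
have bernoulli n : 1 + n%:R * (z - 1) <= z ^+ n.
  elim: n => [|n ih]; first by rewrite mul0r addr0 expr0.
  rewrite exprS -natr1.
  have : z * (1 + n%:R * (z - 1)) <= z * z ^+ n by rewrite ler_wpM2l.
  have : 0 <= n%:R * (z - 1) * (z - 1).
    by rewrite !mulr_ge0// subr_ge0 ltW.
  nra.
have := hz (Num.truncn (K / (z - 1))).+1; apply/negP; rewrite -ltNge.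
apply: lt_le_trans (bernoulli _).
have := truncnS_gt (K / (z - 1)).
rewrite ltr_pdivrMr; last by rewrite subr_gt0.
by lra.
Qed.

(** Pigeonhole: two points in the same cell of a grid of step [h] are too close
    to be separated, and the bounded region meets few cells. *)
Lemma separated_card (T : finType) (F : T -> 'cV[R]_N) a S (D h : R) :
  0 <= a -> 0 < h -> (forall t, supported S (F t)) ->
  (forall t j, `|F t j ord0| <= D) ->
  (forall t t', t != t' -> N%:R * h `^ a < power_sum a (F t - F t')) ->
  (#|T| <= (Num.truncn (2 * D / h)).+1 ^ #|S|)%N.
Proof.
move=> a0 h0 hS hD hsep; set L := Num.truncn _.
pose c t j : R := (F t j ord0 + D) / h.
have c0 t j : 0 <= c t j.
  by rewrite divr_ge0 ?(ltW h0)//; have := hD t j; rewrite ler_norml; lra.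
have cL t j : (Num.truncn (c t j) < L.+1)%N.
  rewrite ltnS; apply: le_truncn; rewrite ler_pM2r ?invr_gt0//.
  by have := hD t j; rewrite ler_norml; lra.
pose cell t : {ffun 'I_N -> 'I_L.+1} :=
  [ffun j => if j \in S then Ordinal (cL t j) else ord0].
have cell_inj : injective cell.
  move=> t t' tt'; apply/eqP; apply/negPn/negP => ntt'.
  have := hsep _ _ ntt'; apply/negP; rewrite -leNgt.
  rewrite /power_sum; apply: (@le_trans _ _ (\sum_(j < N) h `^ a)); last first.
    by rewrite sumr_const card_ord mulr_natl.
  apply: ler_sum => j _; apply: le_powR => //; rewrite !mxE.
  have [jS|jS] := boolP (j \in S); last by rewrite !hS// subr0 normr0 ltW.
  have := congr1 (fun g : {ffun 'I_N -> 'I_L.+1} => val (g j)) tt'.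
  rewrite !ffunE jS/= => e.
  have /andP[l1 u1] := truncn_itv (c0 t j).
  have /andP[l2 u2] := truncn_itv (c0 t' j).
  rewrite e -natr1 in l1 u1; rewrite -natr1 in u2.
  have : `|c t j - c t' j| <= 1 by rewrite ler_norml; lra.
  rewrite /c -mulrBl normrM (gtr0_norm (x := h^-1)) ?invr_gt0// ler_pdivrMr//.
  by rewrite mul1r opprD addrACA subrr addr0.
rewrite -(card_codom cell_inj) -[in leqRHS](card_ord L.+1).
rewrite -(card_pffun_on (@ord0 L)); apply: subset_leq_card.
apply/fintype.subsetP => _ /codomP[t ->]; apply/pffun_onP; split=> //.
by apply/supportP => j jS; rewrite ffunE (negbTE jS).
Qed.

Lemma supported_address (I : eqType) (y : I -> 'cV[R]_N) b S w :
  (forall i, supported S (y i)) -> supported S (address (y := y) b w).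
Proof.
move=> hS; elim: w => [|i w ih] j jS /=; first by rewrite mxE.
by rewrite !mxE hS// ih// mulr0 addr0.
Qed.

(** The volume bound for separated sets, obtained without any volume.  With
    [lambda = (3 / r)^(1/a)] and [b = 1 / lambda], a separated family of [m]
    points yields [m ^ n] addresses of length [n] which stay in a fixed cube and
    are separated at scale [lambda ^- n].  Grid cells then give
    [m ^ n <= c (lambda ^ n) ^ #|S|] with [c] independent of [n], which forces
    [m <= lambda ^ #|S|]. *)
Lemma packing_bound (I : finType) (y : I -> 'cV[R]_N) a r S :
  0 < a <= 1 -> 0 < r <= 3^-1 ->
  (forall i, supported S (y i)) -> (forall i, power_sum a (y i) <= 1) ->
  (forall i i', i != i' -> r < power_sum a (y i - y i')) ->
  #|I|%:R <= ((3 / r) `^ a^-1) ^+ #|S|.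
Proof.
move=> ha hr hS hy hsep.
have /andP[a0 a1] := ha; have /andP[r0 r3] := hr.
have an0 : a != 0 by rewrite gt_eqF.
have hq := @power_sum_pseminorm R N a ha.
set lambda := (3 / r) `^ a^-1.
have l0 : 0 < lambda by rewrite powR_gt0// divr_gt0.
have l1 : 1 <= lambda.
  rewrite -[leLHS](congr1 (@^~ a^-1) (@powR1 R)).
  apply: le_powR => //; first by rewrite invr_ge0 ltW.
  by rewrite ler_pdivlMr//; lra.
have hla : lambda^-1 `^ a = r / 3.
  by rewrite powR_invr ?(ltW l0)// powRVK// ?divr_ge0 ?(ltW r0)// invf_div.
have hb : `|lambda^-1| `^ a = r / 3 by rewrite gtr0_norm ?invr_gt0.
pose h0 : R := (r / (4 * N.+1%:R)) `^ a^-1.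
have r4 : 0 < r / (4 * N.+1%:R) by rewrite divr_gt0// mulr_gt0.
have h0_gt0 : 0 < h0 by rewrite powR_gt0.
pose D : R := 2 `^ a^-1.
have D0 : 0 <= D by exact: powR_ge0.
pose K : R := 2 * D / h0.
have K0 : 0 <= K by rewrite divr_ge0 ?mulr_ge0 ?(ltW h0_gt0).
(* [h0 * lambda ^- n] is the grid step for which [N] coordinates cannot make up
   the separation [(r / 3) ^+ n * (r / 4)]; [N.+1] avoids dividing by 0. *)
have count n : (#|I| ^ n <= (Num.truncn (K * lambda ^+ n)).+1 ^ #|S|)%N.
  rewrite -card_tuple.
  have := @separated_card (n.-tuple I) (fun w => address (y := y) lambda^-1 w)
    a S D (h0 * lambda ^- n) (ltW a0).
  have -> : 2 * D / (h0 * lambda ^- n) = K * lambda ^+ n.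
    by rewrite invfM invrK mulrA.
  apply.
  - by rewrite mulr_gt0// invr_gt0 exprn_gt0.
  - by move=> w; exact: supported_address.
  - move=> w j; rewrite -[leLHS](@powRKV _ a)//.
    apply: le_powR; rewrite ?invr_ge0 ?powR_ge0 ?(ltW a0)//.
    apply: le_trans (power_sum_ge _ _ _) _.
    apply: le_trans (address_le hq hy an0 _ _) _; last lra.
    by rewrite hb; lra.
  - move=> w w' nww'.
    have := address_separated hq hy an0 hr hb hsep.
    move=> /(_ w w'); rewrite !size_tuple => /(_ erefl nww'); apply: le_lt_trans.
    rewrite powRM ?(ltW h0_gt0) ?invr_ge0 ?exprn_ge0 ?(ltW l0)// powRVK ?(ltW r4)//.
    rewrite -exprVn powRXn ?invr_ge0 ?(ltW l0)// hla mulrA mulrC.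
    apply: ler_wpM2l; first by apply: exprn_ge0; lra.
    rewrite mulrA ler_pdivrMr ?mulr_gt0//.
    have -> : r / 4 * (4 * N.+1%:R) = N.+1%:R * r by field.
    by rewrite ler_pM2r// ler_nat.
have lk0 : 0 < lambda ^+ #|S| by rewrite exprn_gt0.
rewrite -[leRHS]mul1r -ler_pdivrMr//.
apply: (@bounded_powers_le1 _ ((K + 1) ^+ #|S|)); first by rewrite divr_ge0 ?(ltW lk0).
move=> n; rewrite expr_div_n ler_pdivrMr ?exprn_gt0// exprAC -exprMn -natrX.
apply: le_trans (_ : (((Num.truncn (K * lambda ^+ n)).+1 ^ #|S|)%N)%:R <= _).
  by rewrite ler_nat.
rewrite natrX lerXn2r ?nnegrE ?mulr_ge0 ?addr_ge0 ?exprn_ge0 ?(ltW l0)//.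
rewrite -natr1 mulrDl mul1r lerD ?exprn_ege1//.
by rewrite truncn_le mulr_ge0 ?exprn_ge0 ?(ltW l0).
Qed.

End Packing.

(** * The constants of the sample size *)

Section Constants.
Context {R : realType}.

(** ['C(N, k) <= N^k / k!], and [k^k / k! <= e^k] is a single term of the
    exponential series. *)
Lemma bin_le_expR (N k : nat) : (0 < k)%N ->
  'C(N, k)%:R <= (expR 1 * N%:R / k%:R : R) ^+ k.
Proof.
move=> k0.
have ffact_le m n : (m ^_ n <= m ^ n)%N.
  elim: n => [|n ih]; first by rewrite ffactn0 expn0.
  by rewrite ffactnSr expnSr leq_mul// leq_subr.
have kk : (k%:R : R) ^+ k <= expR 1 ^+ k * k`!%:R.
  have := @expR_ge1Dxn R k%:R k.-1 (ler0n _ _); rewrite prednK// => h.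
  rewrite -ler_pdivrMr ?ltr0n ?fact_gt0// -expRM_natl mulr1.
  by apply: le_trans h; rewrite lerDr.
have kp : 0 < (k%:R : R) ^+ k by rewrite exprn_gt0// ltr0n.
rewrite expr_div_n ler_pdivlMr// exprMn.
apply: le_trans (_ : 'C(N, k)%:R * (expR 1 ^+ k * k`!%:R) <= _).
  by rewrite ler_wpM2l.
rewrite mulrCA ler_pM2l ?exprn_gt0 ?expR_gt0// -natrM bin_ffact -natrX.
by rewrite ler_nat.
Qed.

(** With [s = 1 / a >= 1], [Cnet a] is the mean of [4^s] and [2^s], which
    dominates [3^s] by convexity. *)
Lemma Cnet_ge (a : R) : 0 < a < 1 -> 3 `^ a^-1 <= Cnet a.
Proof.
move=> /andP[a0 a1]; have s1 : 1 <= a^-1 by rewrite invf_ge1// ltW.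
have conv : 3 `^ a^-1 <= 2^-1 * 4 `^ a^-1 + 2^-1 * (2 : R) `^ a^-1.
  have -> : (3 : R) = 2^-1 * 4 + 2^-1 * 2 by field.
  rewrite {2 4}(_ : 2^-1 = 1 - 2^-1); last by field.
  apply: (convex_powR s1 (Itv01 _ _)) => //=;
    rewrite ?inE/= ?in_itv/= ?andbT ?invr_ge0 ?invf_le1 ?ler1n ?ler0n//; lra.
rewrite /Cnet powRB ?pnatr_eq0 ?implybT// powRr1//.
have e4 : (4 : R) `^ a^-1 = (2 `^ a^-1) ^+ 2.
  by rewrite -powRXn//; congr (_ `^ _); ring.
by move: conv; rewrite e4; lra.
Qed.

End Constants.

(** * From a net to all supported vectors *)

Section Nets.
Context {R : realType} {N : nat}.
Implicit Types (a r p : R) (S : {set 'I_N}) (x y : 'cV[R]_N).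

Definition sphere a S x := supported S x /\ power_sum a x = 1.

(** A separated family of maximal size covers, since a point left uncovered
    could be added to it; the packing bound makes the maximum exist. *)
Lemma exists_net a r S : 0 < a <= 1 -> 0 < r <= 3^-1 ->
  exists s : seq 'cV[R]_N,
  [/\ (size s)%:R <= ((3 / r) `^ a^-1) ^+ #|S|,
      forall y, y \in s -> sphere a S y &
      forall x, sphere a S x -> exists2 y, y \in s & power_sum a (x - y) <= r].
Proof.
move=> ha hr; have hq := @power_sum_pseminorm R N a ha.
pose sep (s : seq 'cV[R]_N) := (forall y, y \in s -> sphere a S y) /\
  pairwise (fun x y => r < power_sum a (x - y)) s.
have sep_size s : sep s -> (size s)%:R <= ((3 / r) `^ a^-1) ^+ #|S|.
  move=> [s1 /(pairwiseP 0) s2].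
  have := @packing_bound R N 'I_(size s) (fun i => s`_i) a r S ha hr.
  rewrite card_ord; apply=> [i|i|i i' ii'].
  - by have [] := s1 _ (mem_nth 0 (ltn_ord i)).
  - by have [_ ->] := s1 _ (mem_nth 0 (ltn_ord i)).
  - have [lt|lt|/val_inj/eqP] := ltngtP i i'; last by rewrite (negbTE ii').
      by apply: s2; rewrite ?inE.
    by rewrite (pseminorm_distC _ _ hq); apply: s2; rewrite ?inE.
pose P n := `[< exists2 s, sep s & size s = n >].
have exP : exists n, P n by exists 0%N; apply/asboolP; exists [::].
have ubP n : P n -> (n <= Num.truncn (((3 / r) `^ a^-1) ^+ #|S|))%N.
  move=> /asboolP[s hs <-]; rewrite truncn_ge_nat; first exact: sep_size.
  by rewrite exprn_ge0 ?powR_ge0.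
have [n /asboolP[s hs sn] nmax] := ex_maxnP exP ubP.
exists s; split; [exact: sep_size|by case: hs|move=> x hx].
apply/not_exists2P => far; case: hs => s1 s2.
have /nmax : P n.+1; last by rewrite ltnn.
apply/asboolP; exists (x :: s); last by rewrite /= sn.
split; first by move=> y; rewrite inE => /predU1P[->|/s1].
rewrite pairwise_cons s2 andbT; apply/allP => y ys.
by have [//|/negP] := far y; rewrite -ltNge.
Qed.

Lemma normalize a x : 0 < a -> x != 0 ->
  exists u, power_sum a u = 1 /\ x = quasinorm a x *: u.
Proof.
move=> a0 x0.
have q0 : 0 < power_sum a x.
  rewrite lt_def sumr_ge0 ?andbT => [|j _]; last exact: powR_ge0.
  by apply: contra_neq x0; exact: power_sum_eq0.
have c0 : 0 < quasinorm a x by rewrite powR_gt0.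
exists ((quasinorm a x)^-1 *: x); split; last first.
  by rewrite scalerA divff ?scale1r ?gt_eqF.
rewrite {1}/power_sum.
under eq_bigr do rewrite mxE normrM powRM//.
rewrite -mulr_sumr gtr0_norm ?invr_gt0// powR_invr ?(ltW c0)//.
by rewrite powRVK ?(ltW q0) ?gt_eqF// mulVf ?gt_eqF.
Qed.

(** Homogeneity: a relation between [f] and a power of the quasinorm that is
    invariant under scaling need only be checked on the unit sphere. *)
Lemma sphere_to_all a p S (f : 'cV[R]_N -> R) (P : R -> R -> Prop) :
  0 < a -> 0 < p -> pseminorm p f ->
  P 0 0 -> (forall c u v, 0 <= c -> P u v -> P (c * u) (c * v)) ->
  (forall x, sphere a S x -> P (f x) 1) ->
  forall x, supported S x -> P (f x) (quasinorm a x `^ p).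
Proof.
move=> a0 p0 hf P0 PZ hP x xS; have [->|x0] := eqVneq x 0.
  rewrite (pseminorm0 _ hf) ?gt_eqF// (_ : _ `^ p = 0)//.
  rewrite /quasinorm big1 ?powR0 ?invr_eq0 ?gt_eqF// => j _.
  by rewrite mxE normr0 powR0 ?gt_eqF.
have [u [qu xu]] := normalize a0 x0.
have c0 : 0 < quasinorm a x.
  by rewrite lt_def powR_ge0 andbT; apply: contra_neq x0 => c0; rewrite xu c0 scale0r.
case: (hf) => _ _ hZ; rewrite {1}xu hZ gtr0_norm//.
rewrite -[X in P _ X]mulr1; apply: PZ; first exact: powR_ge0.
apply: hP; split=> // j /xS; rewrite xu mxE => /eqP.
by rewrite mulf_eq0 gt_eqF//= => /eqP.
Qed.

(** Let [B] be the supremum of [f] on the sphere.  A net point [y] with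
    [power_sum a (x - y) <= (delta / 3)^(a / p)] satisfies
    [f (x - y) <= (delta / 3) B], so [B <= (1 + delta / 3) A + (delta / 3) B], whence [B <= (1 + delta) A].
    Feeding this bound back into [f y <= f x + f (x - y)] gives the lower
    bound. *)
Lemma net_concentration (f : 'cV[R]_N -> R) a p (A delta : R) S
    (s : seq 'cV[R]_N) :
  0 < p < a -> a <= 1 -> 0 < delta < 1 -> 0 <= A -> pseminorm p f ->
  (forall y, y \in s -> supported S y /\ `|f y - A| <= delta / 3 * A) ->
  (forall x, sphere a S x ->
     exists2 y, y \in s & power_sum a (x - y) <= (delta / 3) `^ (a / p)) ->
  forall x, supported S x ->
    (1 - delta) * A * quasinorm a x `^ p <= f x
      <= (1 + delta) * A * quasinorm a x `^ p.
Proof.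
move=> /andP[p0 pa] a1 /andP[d0 d1] A0 hf hs hnet.
have a0 : 0 < a by lra.
case: (hf) => f0 fD fZ.
apply: (@sphere_to_all a p S f
  (fun u v => (1 - delta) * A * v <= u <= (1 + delta) * A * v)) => //.
- by rewrite !mulr0 lexx.
- move=> c u v c0 /andP[h1 h2].
  by rewrite !(mulrCA _ c) !ler_wpM2l.
move=> x0 hx0; rewrite !mulr1.
pose E := [set f x | x in sphere a S].
have E0 : E !=set0 by exists (f x0), x0.
have Eub : has_ubound E.
  exists (\sum_(j < N) f (delta_mx j ord0)) => _ [x [xS qx] <-].
  apply: le_trans (le_pseminorm_coord _ _ hf) _; first by rewrite gt_eqF.
  apply: ler_sum => j _; apply: ler_piMl => //.
  rewrite -(powRKV (x := `|x j ord0|) (p := a)) ?gt_eqF// -powRrM.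
  rewrite -(congr1 (@^~ (a^-1 * p)) (@powR1 R)) /=.
  apply: le_powR; rewrite ?powR_ge0 ?mulr_ge0 ?invr_ge0 ?(ltW a0) ?(ltW p0)//.
  by rewrite -qx; exact: power_sum_ge.
pose B := sup E.
have fB x : sphere a S x -> f x <= B by move=> hx; apply: ub_le_sup => //; exists x.
have B0 : 0 <= B by apply: le_trans (fB _ hx0).
have small z : supported S z -> power_sum a z <= (delta / 3) `^ (a / p) ->
    f z <= delta / 3 * B.
  move=> zS qz.
  apply: le_trans (_ : B * quasinorm a z `^ p <= _).
    apply: (@sphere_to_all a p S f (fun u v => u <= B * v)) => //.
    - by rewrite mulr0.
    - by move=> c u v c0 h; rewrite mulrCA ler_wpM2l.
    - by move=> x hx; rewrite mulr1; exact: fB.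
  rewrite mulrC ler_wpM2r// /quasinorm -powRrM mulrC.
  have ap0 : 0 < a / p by rewrite divr_gt0.
  have d30 : 0 <= delta / 3 by lra.
  rewrite -[leRHS](@powRKV _ (a / p)) ?gt_eqF//.
  rewrite invf_div; apply: le_powR => //; first by rewrite divr_ge0 ?ltW.
  by apply: sumr_ge0 => j _; exact: powR_ge0.
have close x : sphere a S x ->
    (1 - delta / 3) * A - delta / 3 * B <= f x <= (1 + delta / 3) * A + delta / 3 * B.
  move=> hx; have [y ys xy] := hnet x hx; have [yS] := hs y ys.
  rewrite ler_norml => /andP[l u].
  have zS : supported S (x - y) by move=> j jS; rewrite !mxE yS// (hx.1 _ jS) subr0.
  have := small _ zS xy; have := pseminorm_leD x y hf.
  have := pseminorm_leD y x hf; rewrite (pseminorm_distC y x hf); lra.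
have BA : B <= (1 + delta / 3) * A + delta / 3 * B.
  by apply: ge_sup => // _ [x /close/andP[_ h] <-].
have Ad : 0 <= A * (delta * (1 - delta)) by rewrite !mulr_ge0//; lra.
have BA' : B <= (1 + delta) * A.
  have : B * (3 - delta) <= (3 + delta) * A by lra.
  have : (3 + delta) * A <= (1 + delta) * A * (3 - delta) by lra.
  move=> h1 h2; rewrite -(@ler_pM2r _ (3 - delta)); last lra.
  exact: le_trans h1.
have /andP[l _] := close _ hx0; rewrite (le_trans (fB _ hx0) BA') andbT.
have : delta * B <= delta * ((1 + delta) * A) by rewrite ler_pM2l.
by lra.
Qed.

(** Keeping the zero coordinates exact is what preserves sparsity. *)
Lemma rational_approx x (e : R) : 0 < e -> exists y : 'cV[rat]_N,
  forall j, `|x j ord0 - ratr (y j ord0)| <= e /\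
            (x j ord0 = 0 -> y j ord0 = 0).
Proof.
move=> e0.
have h j : exists c : rat, `|x j ord0 - ratr c| <= e /\ (x j ord0 = 0 -> c = 0).
  have [xj0|xj0] := eqVneq (x j ord0) 0.
    by exists 0; rewrite xj0 rmorph0 subr0 normr0 ltW.
  have [|c] := @rat_in_itvoo R (x j ord0) (x j ord0 + e); first by rewrite ltrDl.
  rewrite in_itv/= => /andP[c1 c2]; exists c; split => [|/eqP].
    by rewrite ler_norml; lra.
  by rewrite (negbTE xj0).
exists (\col_j sval (cid (h j))) => j; rewrite mxE.
exact: (svalP (cid (h j))).
Qed.

(** Continuity of p-seminorms reduces the uncountable family of constraints of
    the RQIP to a countable one, which makes the event measurable. *)
Lemma rational_pseminorm_le p (f g : 'cV[R]_N -> R) k : 0 < p ->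
  pseminorm p f -> pseminorm p g ->
  (forall y : 'cV[rat]_N, sparse k (map_mx ratr y : 'cV[R]_N) ->
     f (map_mx ratr y) <= g (map_mx ratr y)) ->
  forall x, sparse k x -> f x <= g x.
Proof.
move=> p0 hf hg fg x xk; rewrite leNgt; apply/negP => gf.
have f0 := let: And3 h _ _ := hf in h; have g0 := let: And3 h _ _ := hg in h.
pose K := \sum_(j < N) (f (delta_mx j ord0) + g (delta_mx j ord0)).
have K0 : 0 <= K by apply: sumr_ge0 => j _; rewrite addr_ge0.
pose D := (f x - g x) / (K + 1).
have D0 : 0 < D by rewrite divr_gt0 ?subr_gt0// ltr_wpDl.
have [y hy] := @rational_approx x (D `^ p^-1) (powR_gt0 _ D0).
pose y' : 'cV[R]_N := map_mx ratr y.
have yk : sparse k y'.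
  apply: leq_trans xk; apply: subset_leq_card; apply/fintype.subsetP => j.
  rewrite !inE; apply: contra_neq => xj; rewrite mxE.
  by rewrite (hy j).2// rmorph0.
have : f (x - y') + g (x - y') <= D * K.
  apply: le_trans (lerD (le_pseminorm_coord _ _ hf) (le_pseminorm_coord _ _ hg)) _;
    rewrite ?gt_eqF//.
  rewrite -big_split/= mulr_sumr; apply: ler_sum => j _.
  rewrite -mulrDr ler_wpM2r ?addr_ge0//.
  rewrite -[leRHS](@powRVK _ p) ?gt_eqF ?(ltW D0)//; apply: le_powR => //.
    exact: ltW.
  by rewrite !mxE (hy j).1.
have DK : D * K + D = f x - g x.
  by rewrite -[X in _ + X]mulr1 -mulrDr divfK// gt_eqF// ltr_wpDl.
have := fg y yk; have := pseminorm_leD x y' hf.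
have := pseminorm_leD y' x hg; rewrite (pseminorm_distC y' x hg); lra.
Qed.

Lemma sparse_supported k x : (k <= N)%N -> sparse k x ->
  exists2 S : {set 'I_N}, #|S| = k & supported S x.
Proof.
move=> kN xk; pose A := [set j : 'I_N | x j ord0 != 0]%SET.
pose good (S : {set 'I_N}) := (A \subset S) && (#|S| <= k)%N.
have gA : good A by rewrite /good subxx.
case: (arg_maxnP (fun S : {set 'I_N} => #|S|) gA) => S /andP[AS Sk] Smax.
exists S => [|j jS]; last first.
  apply/eqP; apply: contraNT jS => xj; apply: (fintype.subsetP AS).
  by rewrite inE.
apply/eqP; rewrite eqn_leq Sk leqNgt; apply/negP => Slt.
have : (#|~: S| > 0)%N.
  by rewrite -(ltn_add2l #|S|) addn0 cardsC card_ord (leq_trans Slt kN).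
case/card_gt0P => j; rewrite inE => jS.
have /Smax : good (j |: S)%SET.
  by rewrite /good cardsU1 jS Slt andbT (fintype.subset_trans AS)// finset.subsetUr.
by rewrite /= cardsU1 jS ltnn.
Qed.

End Nets.

(** * Independent pairs *)

Section PairLaw.
Context {d : measure_display} {T : measurableType d} {R : realType}.
Context {P : probability T R} (X1 X2 : {RV P >-> R}).

(** The product form on rectangles determines the law of the pair.  The event
    [C] carries along the other variables of a family, so that independence of
    the pair from the rest is obtained at the same time. *)
Lemma pair_law (C : set T) : measurable C ->
  (forall A B, measurable A -> measurable B ->
    P ((X1 @^-1` A `&` X2 @^-1` B) `&` C)
      = (P (X1 @^-1` A) * P (X2 @^-1` B) * P C)%E) ->
  forall D : set (R * R), measurable D ->
    P ((fun w => (X1 w, X2 w)) @^-1` D `&` C)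
      = ((distribution P X1 \x distribution P X2) D * P C)%E.
Proof.
move=> mC hAB D mD.
have mX : measurable_fun setT (fun w => (X1 w, X2 w)).
  exact: measurable_fun_pair.
pose X : {mfun T >-> (R * R)%type} := mfun_Sub (mem_set mX).
(* If [P C] is not 0, conditioning on [C] turns the claim into the uniqueness of
   the product measure. *)
have [PC0|PC0] := eqVneq (P C) 0%E.
  rewrite PC0 mule0; apply: le_anti; rewrite measure_ge0 andbT -PC0.
  apply: le_measure; rewrite ?inE//.
  by apply: measurableI => //; rewrite -[_ @^-1` _]setTI; exact/(mX measurableT).
have PCfin : P C \is a fin_num by exact: fin_num_measure.
have c0 : 0 < fine (P C).
  by rewrite fine_gt0// lt0e PC0 measure_ge0/= -ge0_fin_numE.
have ic0 : 0 <= (fine (P C))^-1 by rewrite invr_ge0 ltW.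
have @m : {measure set (R * R) -> \bar R}.
  by refine (mscale (NngNum ic0) (pushforward (mrestr P mC) X)); exact: mX.
have mE A : m A = ((fine (P C))^-1%:E * P (X @^-1` A `&` C))%E by [].
have hm A B : measurable A -> measurable B ->
    m (A `*` B) = (distribution P X1 A * distribution P X2 B)%E.
  move=> mA mB; rewrite mE.
  have -> : X @^-1` (A `*` B) = X1 @^-1` A `&` X2 @^-1` B by [].
  rewrite hAB// muleC -muleA -[X in (_ * (X * _))%E](fineK PCfin) -EFinM.
  by rewrite divff ?gt_eqF// mule1.
rewrite (product_measure_unique hm mD) mE muleAC -[X in (_ * X * _)%E](fineK PCfin).
by rewrite -EFinM mulVf ?gt_eqF// mul1e.
Qed.

Hypothesis indep : forall A B, measurable A -> measurable B ->
  P (X1 @^-1` A `&` X2 @^-1` B) = (P (X1 @^-1` A) * P (X2 @^-1` B))%E.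

Lemma bounded_RV_integrable (d' : measure_display) (T' : measurableType d')
    (Q : probability T' R) (h : T' -> R) : measurable_fun setT h ->
  (forall x, `|h x| <= 1) -> Q.-integrable setT (EFin \o h).
Proof.
move=> mh h1; apply: measurable_bounded_integrable => //.
  by rewrite (le_lt_trans (probability_le1 _ _))// ltry.
exists 1; split=> // M M1 x _ /=; exact: le_trans (h1 x) (ltW M1).
Qed.

Lemma Rintegral_indep_mul (f g : R -> R) :
  measurable_fun setT f -> measurable_fun setT g ->
  (forall x, `|f x| <= 1) -> (forall x, `|g x| <= 1) ->
  (\int[P]_w (f (X1 w) * g (X2 w)))%R
    = (\int[P]_w f (X1 w))%R * (\int[P]_w g (X2 w))%R.
Proof.
move=> mf mg f1 g1.
pose h (z : R * R) := f z.1 * g z.2.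
have mh : measurable_fun setT h.
  by apply: measurable_funM; apply: measurableT_comp.
have h1 z : `|h z| <= 1 by rewrite normrM mulr_ile1.
have mX : measurable_fun setT (fun w => (X1 w, X2 w)).
  exact: measurable_fun_pair.
pose X : {mfun T >-> (R * R)%type} := mfun_Sub (mem_set mX).
have law A : measurable A ->
    distribution P X A = ((distribution P X1 \x distribution P X2) A)%E.
  move=> mA; have hT B C : measurable B -> measurable C ->
      P ((X1 @^-1` B `&` X2 @^-1` C) `&` setT)
        = (P (X1 @^-1` B) * P (X2 @^-1` C) * P setT)%E.
    by move=> mB mC; rewrite setIT probability_setT mule1 indep.
  by have := pair_law measurableT hT mA; rewrite setIT probability_setT mule1.
have i1 : P.-integrable setT (EFin \o (f \o X1)).
  by apply: bounded_RV_integrable => [|x]; [exact: measurableT_comp|exact: f1].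
have i2 : P.-integrable setT (EFin \o (g \o X2)).
  by apply: bounded_RV_integrable => [|x]; [exact: measurableT_comp|exact: g1].
have e2 : (\int[distribution P X2]_y (g y)%:E = (\int[P]_w g (X2 w))%:E)%E.
  rewrite (@integral_distribution _ _ _ _ _ _ X2 (EFin \o g))//.
    by rewrite /Rintegral fineK//; exact: integrable_fin_num.
  exact/measurable_EFinP.
have e1 : (\int[distribution P X1]_y (f y)%:E = (\int[P]_w f (X1 w))%:E)%E.
  rewrite (@integral_distribution _ _ _ _ _ _ X1 (EFin \o f))//.
    by rewrite /Rintegral fineK//; exact: integrable_fin_num.
  exact/measurable_EFinP.
have ih : P.-integrable setT ((EFin \o h) \o X).
  by apply: (@bounded_RV_integrable _ _ P (h \o X)) => [|x];
    [exact: measurableT_comp|exact: h1].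
have hX : (\int[P]_w (h (X w))%:E = \int[distribution P X]_z (h z)%:E)%E.
  rewrite (@integral_distribution _ _ _ _ _ _ X (EFin \o h))//.
  exact/measurable_EFinP.
rewrite [LHS]/Rintegral.
have -> : (\int[P]_w (f (X1 w) * g (X2 w))%:E = \int[distribution P X]_z (h z)%:E)%E.
  by rewrite -hX.
rewrite (eq_measure_integral (distribution P X1 \x distribution P X2)%E); last first.
  by move=> A mA _; exact: law.
rewrite -(@integral12_prod_meas1 _ _ _ _ _ _ _ (EFin \o h)); last first.
  have /integrableP[mEh hoo] := @bounded_RV_integrable _ _ (distribution P X) _ mh h1.
  apply/integrableP; split=> //; apply: le_lt_trans hoo.
  rewrite le_eqVlt; apply/orP; left; apply/eqP.
  by apply: eq_measure_integral => A mA _; rewrite [RHS]law.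
rewrite (eq_integral (fun x => (f x)%:E * (\int[P]_w g (X2 w))%:E)%E); last first.
  move=> x _ /=; rewrite -e2 /fubini_F.
  under eq_integral do rewrite /h/= EFinM.
  rewrite integralZl//; apply: bounded_RV_integrable => //.
rewrite integralZr//; last exact: bounded_RV_integrable.
by rewrite e1 -EFinM.
Qed.

End PairLaw.

(** * Merging independent variables *)

Section Independence.
Context {d : measure_display} {T : measurableType d} {R : realType}.
Context {P : probability T R}.

Lemma RV_preimage (X : {RV P >-> R}) (B : set R) :
  measurable B -> measurable (X @^-1` B).
Proof. by move=> mB; rewrite -[_ @^-1` _]setTI; exact: measurable_funPT. Qed.

Lemma measurable_inter (I : finType) (X : I -> {RV P >-> R}) (J : {set I})
    (B : I -> set R) : (forall i, measurable (B i)) ->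
  measurable [set w | forall i, i \in J -> B i (X i w)].
Proof.
move=> mB.
have -> : [set w | forall i, i \in J -> B i (X i w)]
    = \bigcap_(i in [set` J]) (X i @^-1` B i).
  by apply/seteqP; split=> w /= h i; exact: h.
by apply: fin_bigcap_measurable => // i _; exact: RV_preimage.
Qed.

(** Taking [B i] to be the whole line outside [J] recovers the product rule for
    the subfamily indexed by [J]. *)
Lemma mutually_independent_full (I : finType) (X : I -> {RV P >-> R}) :
  (forall B : I -> set R, (forall i, measurable (B i)) ->
    P [set w | forall i, B i (X i w)] = (\prod_i P (X i @^-1` B i))%E) ->
  mutually_independent X.
Proof.
move=> h J B mB.
pose B' i := if i \in J then B i else setT.
have mB' i : measurable (B' i) by rewrite /B'; case: ifP.
have -> : [set w | forall i, i \in J -> B i (X i w)]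
    = [set w | forall i, B' i (X i w)].
  apply/seteqP; split=> w /= hw i; first by rewrite /B'; case: ifP => // /hw.
  by move=> iJ; have := hw i; rewrite /B' iJ.
rewrite h// [RHS]big_mkcond/=; apply: eq_bigr => i _; rewrite /B'.
by case: ifP => // _; rewrite preimage_setT probability_setT.
Qed.

Section Merge.
Context {I : finType} (X : I -> {RV P >-> R}) (a b : I).

(** Putting 0 in place of [X b] keeps the index type fixed, so that merges can
    be iterated; a constant is independent of everything. *)
Definition merge (i : I) : {RV P >-> R} :=
  if i == a then X a + X b else if i == b then 0 else X i.

Hypotheses (ab : a != b) (hX : mutually_independent X).

Let others : {set I} := [set i | (i != a) && (i != b)]%SET.

Let triple (A1 A2 : set R) (B : I -> set R) : measurable A1 -> measurable A2 ->
  (forall i, measurable (B i)) ->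
  let C := [set w | forall i, i \in others -> B i (X i w)] in
  P ((X a @^-1` A1 `&` X b @^-1` A2) `&` C)
    = (P (X a @^-1` A1) * P (X b @^-1` A2) * P C)%E.
Proof.
move=> mA1 mA2 mB C.
pose B' i := if i == a then A1 else if i == b then A2 else B i.
have ba : (b == a) = false by rewrite eq_sym (negbTE ab).
have mB' i : measurable (B' i) by rewrite /B'; case: ifP => // _; case: ifP.
have B'o i : i \in others -> B' i = B i.
  by rewrite inE /B' => /andP[/negbTE-> /negbTE->].
have -> : X a @^-1` A1 `&` X b @^-1` A2 `&` C
    = [set w | forall i, i \in [set: I]%SET -> B' i (X i w)].
  apply/seteqP; split=> w /=.
    move=> [[h1 h2] hC] i _; rewrite /B'; case: eqVneq => [->//|ia].
    by case: eqVneq => [->//|ib]; apply: hC; rewrite inE ia.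
  move=> h; split; last by move=> i io; rewrite -B'o//; apply: h; rewrite inE.
  split; first by have := h a; rewrite inE /B' eqxx; exact.
  by have := h b; rewrite inE /B' ba eqxx; exact.
rewrite hX// hX// (bigD1 a) ?inE//= (bigD1 b) ?inE ?ba//=.
rewrite {1}/B' eqxx {1}/B' ba eqxx muleA; congr (_ * _)%E.
apply: eq_big => i; first by rewrite !inE.
by rewrite inE /= => io; rewrite B'o// inE.
Qed.

Lemma independent_pair (A1 A2 : set R) : measurable A1 -> measurable A2 ->
  P (X a @^-1` A1 `&` X b @^-1` A2) = (P (X a @^-1` A1) * P (X b @^-1` A2))%E.
Proof.
move=> mA1 mA2; have := @triple A1 A2 (fun=> setT) mA1 mA2 (fun=> measurableT).
have CT : [set w | forall i, i \in others -> [set: R] (X i w)] = setT.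
  by apply/seteqP; split.
by rewrite /= !CT setIT probability_setT mule1.
Qed.

(** Under the product law of [X a] and [X b], the event on their sum is a Borel
    set of the plane, and [pair_law] separates it from the other variables. *)
Lemma mutually_independent_merge : mutually_independent merge.
Proof.
apply: mutually_independent_full => B mB.
have ba : (b == a) = false by rewrite eq_sym (negbTE ab).
pose C := [set w | forall i, i \in others -> B i (X i w)].
have mC : measurable C by exact: measurable_inter.
pose D := [set z : R * R | B a (z.1 + z.2)].
have mD : measurable D.
  rewrite -[D]setTI; apply: (measurable_funD measurable_fst measurable_snd) => //.
have lawC := pair_law mC (fun A1 A2 m1 m2 => triple m1 m2 mB) mD.
have lawT : P ((fun w => (X a w, X b w)) @^-1` D)
    = ((distribution P (X a) \x distribution P (X b)) D)%E.
  have hT A1 A2 : measurable A1 -> measurable A2 ->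
      P ((X a @^-1` A1 `&` X b @^-1` A2) `&` setT)
        = (P (X a @^-1` A1) * P (X b @^-1` A2) * P setT)%E.
    by move=> m1 m2; rewrite setIT probability_setT mule1 independent_pair.
  by have := pair_law measurableT hT mD; rewrite setIT probability_setT mule1.
have ma : merge a = X a + X b by rewrite /merge eqxx.
have mb : merge b = 0 by rewrite /merge ba eqxx.
have mo i : i \in others -> merge i = X i.
  by rewrite inE /merge => /andP[/negbTE-> /negbTE->].
have prodE : (\prod_i P (merge i @^-1` B i) =
    P ((fun w => (X a w, X b w)) @^-1` D) * P (merge b @^-1` B b) * P C)%E.
  rewrite (bigD1 a)//= (bigD1 b) ?ba//= muleA ma; congr (_ * _)%E.
  rewrite hX//; apply: eq_big => i; first by rewrite inE.
  by move=> io; rewrite mo// inE.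
rewrite prodE; have [B0|B0] := pselect (B b 0).
  have -> : P (merge b @^-1` B b) = 1%E.
    rewrite mb (_ : _ @^-1` _ = setT) ?probability_setT//.
    by apply/seteqP; split.
  rewrite mule1 lawT -lawC; congr (P _); apply/seteqP; split=> w /=.
    move=> h; split; first by have := h a; rewrite ma.
    by move=> i io; have := h i; rewrite mo.
  move=> [h1 h2] i; have [->|ia] := eqVneq i a; first by rewrite ma.
  have [->|ib] := eqVneq i b; first by rewrite mb.
  have io : i \in others by rewrite inE ia.
  by rewrite mo//; exact: h2.
have -> : P (merge b @^-1` B b) = 0%E.
  rewrite mb (_ : _ @^-1` _ = set0) ?measure0//.
  by apply/seteqP; split.
rewrite mule0 mul0e (_ : [set w | _] = set0) ?measure0//.
by apply/seteqP; split => // w /(_ b); rewrite mb.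
Qed.

End Merge.

Lemma mutually_independent_comp (I I' : finType) (X : I -> {RV P >-> R})
    (Y : I' -> {RV P >-> R}) (h : I' -> I) (g : I -> I') : cancel h g ->
  (forall i w, Y i w = X (h i) w) -> mutually_independent X ->
  mutually_independent Y.
Proof.
move=> hg YX hX J B mB.
have := hX (h @: J)%SET (B \o g) (fun i => mB (g i)).
rewrite big_imset /=; last by move=> i j _ _ /(can_inj hg).
have -> : [set w | forall i, i \in (h @: J)%SET -> B (g i) (X i w)]
    = [set w | forall i, i \in J -> B i (Y i w)].
  apply/seteqP; split=> w /= hw i.
    by move=> iJ; rewrite YX -{1}(hg i); apply: hw; exact: imset_f.
  by move=> /imsetP[j jJ ->]; rewrite hg -YX; exact: hw.
move=> ->; apply: eq_bigr => i _; rewrite hg; congr (P _).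
by apply/seteqP; split=> w; rewrite /= YX.
Qed.

Lemma mutually_independent_scale (I : finType) (X : I -> {RV P >-> R})
    (c : I -> R) : mutually_independent X ->
  mutually_independent (fun i => c i \o* X i : {RV P >-> R}).
Proof.
move=> hX J B mB.
pose B' i := (fun x => x * c i) @^-1` B i.
have mB' i : measurable (B' i).
  rewrite -[B' i]setTI.
  have mc : measurable_fun setT (fun x : R => x * c i).
    by apply: measurable_funM => //.
  exact: mc.
exact: (hX J B' mB').
Qed.

(** The parameter is the power [s = sigma^alpha] of the scale: unlike the scale,
    it is additive over independent sums, and [s = 0] is allowed. *)
Definition stable_law (alpha s : R) (X : T -> R) := forall t : R,
  char_fun P X t = Complex (expR (- (s * `|t| `^ alpha))) 0.

Lemma stable_law_scale alpha s c (X : T -> R) : stable_law alpha s X ->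
  stable_law alpha (s * `|c| `^ alpha) (fun w => X w * c).
Proof.
move=> hX t; have := hX (t * c); rewrite /char_fun normrM powRM// => -[h1 h2].
congr Complex.
  transitivity (\int[P]_w cos (t * c * X w))%R.
    by apply: eq_Rintegral => w _; rewrite mulrAC -mulrA.
  by rewrite h1; congr (expR _); ring.
transitivity (\int[P]_w sin (t * c * X w))%R; last exact: h2.
by apply: eq_Rintegral => w _; rewrite mulrAC -mulrA.
Qed.

(** The addition formulas split the characteristic function of the sum; the
    terms containing a sine vanish by symmetry. *)
Lemma stable_law_add alpha s1 s2 (X1 X2 : {RV P >-> R}) :
  (forall A B, measurable A -> measurable B ->
    P (X1 @^-1` A `&` X2 @^-1` B) = (P (X1 @^-1` A) * P (X2 @^-1` B))%E) ->
  stable_law alpha s1 X1 -> stable_law alpha s2 X2 ->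
  stable_law alpha (s1 + s2) (X1 + X2).
Proof.
move=> hind h1 h2 t; have [c1 n1] := h1 t; have [c2 n2] := h2 t.
have mcos : measurable_fun setT (fun x : R => cos (t * x)).
  apply: continuous_measurable_fun => x.
  by apply: continuous_comp; [exact: mulrl_continuous|exact: continuous_cos].
have msin : measurable_fun setT (fun x : R => sin (t * x)).
  apply: continuous_measurable_fun => x.
  by apply: continuous_comp; [exact: mulrl_continuous|exact: continuous_sin].
have bcos (x : R) : `|cos (t * x)| <= 1 by rewrite ler_norml cos_geN1 cos_le1.
have bsin (x : R) : `|sin (t * x)| <= 1 by rewrite ler_norml sin_geN1 sin_le1.
have int (f g : R -> R) : measurable_fun setT f -> measurable_fun setT g ->
    (forall x, `|f x| <= 1) -> (forall x, `|g x| <= 1) ->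
    P.-integrable setT (EFin \o (fun w => f (X1 w) * g (X2 w))).
  move=> mf mg bf bg; apply: bounded_RV_integrable => [|w].
    by apply: measurable_funM; exact: measurableT_comp.
  by rewrite normrM mulr_ile1.
rewrite /char_fun; congr Complex.
  transitivity (\int[P]_w (cos (t * X1 w) * cos (t * X2 w)
                           - sin (t * X1 w) * sin (t * X2 w)))%R.
    by apply: eq_Rintegral => w _; rewrite mfunD /= mulrDr cosD.
  rewrite RintegralB//; [|exact: (int _ _ mcos mcos)|exact: (int _ _ msin msin)].
  rewrite (Rintegral_indep_mul hind mcos mcos)//.
  rewrite (Rintegral_indep_mul hind msin msin)//.
  by rewrite n1 c1 c2 mul0r subr0 -expRD -opprD -mulrDl.
transitivity (\int[P]_w (sin (t * X1 w) * cos (t * X2 w)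
                         + cos (t * X1 w) * sin (t * X2 w)))%R.
  by apply: eq_Rintegral => w _; rewrite mfunD /= mulrDr sinD.
rewrite RintegralD//; [|exact: (int _ _ msin mcos)|exact: (int _ _ mcos msin)].
rewrite (Rintegral_indep_mul hind msin mcos)//.
rewrite (Rintegral_indep_mul hind mcos msin)//.
by rewrite n1 n2 mul0r mulr0 addr0.
Qed.

(** Each index [l] of [s] is merged into its representative [r l], which is never
    itself merged away: grouping of independent variables, one step at a time. *)
Lemma merge_fibres (I : finType) (r : I -> I) alpha (X : I -> {RV P >-> R})
    (sc : I -> R) (s : seq I) :
  mutually_independent X -> (forall i, stable_law alpha (sc i) (X i)) ->
  uniq s -> (forall l, l \in s -> r l \notin s) ->
  exists2 Y : I -> {RV P >-> R}, mutually_independent Y &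
    forall i, i \notin s ->
      (forall w, Y i w = X i w + \sum_(l <- s | r l == i) X l w) /\
      stable_law alpha (sc i + \sum_(l <- s | r l == i) sc l) (Y i).
Proof.
move=> hX hsc; elim: s => [_ _|l s ih /= /andP[ls us] hr].
  exists X => // i _; rewrite big_nil addr0.
  by split=> [w|]; rewrite ?big_nil ?addr0.
have [|Y hY hYs] := ih us.
  move=> l' l's; have := hr l'; rewrite !inE l's orbT => /(_ isT).
  by rewrite negb_or => /andP[].
have := hr l; rewrite !inE eqxx => /(_ isT); rewrite negb_or => /andP[al as_].
exists (merge Y (r l) l); first exact: mutually_independent_merge.
have empty (V : nmodType) (F : I -> V) : \sum_(l' <- s | r l' == l) F l' = 0.
  rewrite big_seq_cond big_pred0// => l'; apply/negbTE/negP => /andP[l's /eqP e].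
  by have := hr l'; rewrite e !inE l's orbT eqxx => /(_ isT).
move=> i; rewrite inE negb_or => /andP[il is_]; have [Yi Si] := hYs i is_.
have [Yl Sl] := hYs l ls.
rewrite big_cons [r l == i]eq_sym /merge; case: eqVneq => [ia|ia]; last first.
  rewrite (negbTE il); split=> // w.
  by rewrite Yi big_cons eq_sym (negbTE ia).
rewrite -ia in al as_ *; split=> [w|].
  rewrite mfunD /= Yi Yl empty addr0 big_cons ia eqxx addrCA addrC -!addrA.
  by congr (_ + _); rewrite addrC.
rewrite empty addr0 in Sl; rewrite [sc l + _]addrC addrA.
apply: stable_law_add => // A B mA mB; exact: independent_pair.
Qed.

End Independence.

(** * The empirical moment along a fixed vector *)

Section RowSums.
Context {d : measure_display} {T : measurableType d} {R : realType}.
Context {P : probability T R} {M N : nat}.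
Context (omega : 'I_M * 'I_N -> {RV P >-> R}).
Implicit Types (x : 'cV[R]_N) (w : T).

Definition sample w : 'M[R]_(M, N) := \matrix_(i < M, j < N) omega (i, j) w.

Definition empirical_moment p w x : R :=
  M%:R^-1 * \sum_(i < M) `|(sample w *m x) i ord0| `^ p.

Lemma empirical_moment_pseminorm p w : 0 < p <= 1 ->
  pseminorm p (empirical_moment p w).
Proof.
move=> hp; apply: pseminormZ; first by rewrite invr_ge0.
apply: (@pseminorm_sum _ _ p 'I_M) => i.
apply: (pseminorm_linear hp) => [x y|c x]; first by rewrite mulmxDr mxE.
by rewrite -scalemxAr mxE.
Qed.

Definition row_sum x i : {RV P >-> R} :=
  \sum_(j < N) (x j ord0 \o* omega (i, j) : {RV P >-> R}).

Lemma row_sumE x i w : row_sum x i w = (sample w *m x) i ord0.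
Proof.
by rewrite /row_sum mfun_sum mxE; apply: eq_bigr => j _; rewrite mxE.
Qed.

Lemma measurable_empirical_moment p x :
  measurable_fun setT (fun w => empirical_moment p w x).
Proof.
apply: measurable_funM => //; apply: measurable_sum => i.
apply: (measurableT_comp (measurable_powR p)).
apply: measurableT_comp => //.
apply: (eq_measurable_fun (row_sum x i)) => // w _; exact: row_sumE.
Qed.

(** Each row is merged into its first entry.  The parameters add up to
    [gamma^alpha * sum_j |x_j|^alpha], so on the unit sphere the row sums are
    again symmetric stable with scale [gamma]. *)
Lemma iid_row_sum alpha gamma x : (0 < N)%N ->
  iid_sym_stable alpha gamma omega -> power_sum alpha x = 1 ->
  iid_sym_stable alpha gamma (row_sum x).
Proof.
move=> N0 [hind hst] qx; pose j0 : 'I_N := Ordinal N0.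
pose X l : {RV P >-> R} := x l.2 ord0 \o* omega l.
pose sc (l : 'I_M * 'I_N) := gamma `^ alpha * `|x l.2 ord0| `^ alpha.
have hX : mutually_independent X.
  exact: (mutually_independent_scale (fun l => x l.2 ord0) hind).
have hsc l : stable_law (P := P) alpha (sc l) (X l).
  by apply: stable_law_scale => t; exact: hst.
pose s := [seq l <- enum {: 'I_M * 'I_N} | l.2 != j0].
pose r (l : 'I_M * 'I_N) := (l.1, j0).
have [||Y hY Yr] := merge_fibres (r := r) (s := s) hX hsc.
- by rewrite filter_uniq// enum_uniq.
- by move=> l _; rewrite mem_filter eqxx.
have fibre (V : nmodType) (F : 'I_M * 'I_N -> V) i :
    F (i, j0) + \sum_(l <- s | r l == (i, j0)) F l = \sum_j F (i, j).
  rewrite big_filter_cond big_enum_cond/= (bigD1 j0)//=; congr (_ + _).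
  transitivity (\sum_(l | pred1 i l.1 && (l.2 != j0)) F (l.1, l.2)).
    apply: eq_big => [l|[l1 l2] _ //].
    by rewrite /r xpair_eqE eqxx andbT andbC.
  rewrite -(pair_big (pred1 i) (fun j => j != j0) (fun i j => F (i, j))) /=.
  by rewrite big_pred1_eq.
have Yi i : (forall w, Y (i, j0) w = row_sum x i w) /\
    stable_law (P := P) alpha (gamma `^ alpha) (Y (i, j0)).
  have [|h1 h2] := Yr (i, j0); first by rewrite mem_filter eqxx.
  split=> [w|]; first by rewrite h1 (fibre _ (fun l => X l w)) /row_sum mfun_sum.
  have -> : gamma `^ alpha = \sum_j sc (i, j).
    by rewrite /sc -mulr_sumr /= -/(power_sum alpha x) qx mulr1.
  by rewrite -(fibre _ sc i).
split.
  apply: (@mutually_independent_comp _ _ _ _ _ _ Y _ (fun i => (i, j0)) fst) => //.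
  by move=> i w; rewrite (Yi i).1.
move=> i t; rewrite -(Yi i).2 /char_fun.
by congr Complex; apply: eq_Rintegral => w _; rewrite (Yi i).1.
Qed.

Lemma measurable_RQIP alpha gamma p C delta k :
  0 < p < alpha -> alpha <= 1 -> 0 <= gamma -> 0 <= C -> 0 <= delta <= 1 ->
  measurable [set w | RQIP_with alpha gamma p C delta k (sample w)].
Proof.
move=> /andP[p0 pa] a1 g0 C0 /andP[d0 d1].
pose h b x := b * C * (gamma * quasinorm alpha x) `^ p.
have hh b : 0 <= b -> pseminorm p (h b).
  move=> b0; rewrite (_ : h b = fun x => (b * C * gamma `^ p) * quasinorm alpha x `^ p).
    apply: pseminormZ; first by rewrite !mulr_ge0 ?powR_ge0.
    by apply: quasinorm_pseminorm => //; rewrite p0 ltW.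
  by apply/funext => x; rewrite /h powRM// ?powR_ge0// mulrA.
have hl := hh (1 - delta); have hu := hh (1 + delta).
rewrite subr_ge0 in hl; rewrite addr_ge0// in hu.
have hE w : pseminorm p (empirical_moment p w).
  by apply: empirical_moment_pseminorm; rewrite p0 ltW// (lt_le_trans pa).
pose F n : set T := if choice.unpickle n is Some y
  then let x := map_mx ratr (y : 'cV[rat]_N) in
    [set w | sparse k x -> h (1 - delta) x <= empirical_moment p w x
                             <= h (1 + delta) x]
  else setT.
rewrite (_ : [set w | _] = \bigcap_(n in setT) F n).
  apply: bigcap_measurableType => n _; rewrite /F.
  case: choice.unpickle => [y|//] /=; set x := map_mx _ _.
  have [xk|xk] := boolP (sparse k x); last first.
    by rewrite (_ : [set w | _] = setT)//; apply/seteqP; split.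
  rewrite (_ : [set w | _] = (fun w => empirical_moment p w x) @^-1`
                  `[h (1 - delta) x, h (1 + delta) x]).
    by rewrite -[_ @^-1` _]setTI; exact: measurable_empirical_moment.
  apply/seteqP; split => w /=; rewrite in_itv/=; [exact|by move=> ? _].
apply/seteqP; split=> w /= hw.
  move=> n _; rewrite /F; case: choice.unpickle => //= y; exact: hw.
have ok (y : 'cV[rat]_N) : let x := map_mx ratr y in
    sparse k x -> h (1 - delta) x <= empirical_moment p w x <= h (1 + delta) x.
  by have := hw (choice.pickle y) I; rewrite /F choice.pickleK.
move=> x xk; apply/andP; split.
  apply: (rational_pseminorm_le p0 (hl d1) (hE w)) xk => y /ok.
  by case/andP.
apply: (rational_pseminorm_le p0 (hE w) (hu isT)) xk => y /ok.
by case/andP.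
Qed.

End RowSums.

(** * The union bound over the net *)

Section UnionBound.
Context {d : measure_display} {T : measurableType d} {R : realType}.
Context (P : probability T R).

Lemma union_bound (I : eqType) (s : seq I) (B : I -> set T) (c : R) :
  (forall i, i \in s -> measurable (B i) /\ (P (B i) <= c%:E)%E) ->
  measurable [set w | exists2 i, i \in s & B i w] /\
  (P [set w | exists2 i, i \in s & B i w] <= ((size s)%:R * c)%:E)%E.
Proof.
elim: s => [_|i s ih hB].
  rewrite (_ : [set w | _] = set0) ?measure0 ?mul0r//.
  by apply/seteqP; split => // w [].
have [|m1 b1] := ih; first by move=> j js; apply: hB; rewrite inE js orbT.
have [m2 b2] := hB i (mem_head _ _).
rewrite (_ : [set w | _] = B i `|` [set w | exists2 i, i \in s & B i w]).
  split; first exact: measurableU.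
  apply: le_trans (measureU2 _ m2 m1) _.
  by rewrite /= -natr1 addrC mulrDl mul1r EFinD leeD.
apply/seteqP; split => w /=.
  by move=> [j]; rewrite inE => /predU1P[->|js] Bj; [left|right; exists j].
move=> [Bi|[j js Bj]]; first by exists i; rewrite ?mem_head.
by exists j; rewrite ?inE ?js ?orbT.
Qed.

End UnionBound.

(** One net of radius [(delta / 3)^(alpha / p)] for each support of size [k]; the
    size is the number of supports times the covering bound, where
    [(3 / r)^(1 / alpha) = 3^(1 / alpha) (3 / delta)^(1 / p)]. *)
Lemma net_points (R : realType) (alpha p delta : R) (N k : nat) :
  0 < alpha < 1 -> 0 < p < alpha -> 0 < delta < 1 -> (0 < k)%N ->
  exists L : seq 'cV[R]_N,
  [/\ (size L)%:R <= (expR 1 * N%:R / k%:R) ^+ k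
                     * (Cnet alpha ^+ k * (3 / delta) `^ (k%:R / p)),
      forall y, y \in L -> power_sum alpha y = 1 &
      forall S : {set 'I_N}, #|S| = k ->
      forall x, sphere alpha S x ->
        exists2 y, y \in L /\ supported S y &
          power_sum alpha (x - y) <= (delta / 3) `^ (alpha / p)].
Proof.
move=> ha hp /andP[d0 d1] k0; have /andP[a0 a1] := ha; have /andP[p0 pa] := hp.
pose r := (delta / 3) `^ (alpha / p).
have hr : 0 < r <= 3^-1.
  rewrite powR_gt0 ?divr_gt0//=.
  apply: (@le_trans _ _ (delta / 3)); last by lra.
  apply: ge1r_powR; first by lra.
  by rewrite ler_pdivlMr// mul1r ltW.
have ha1 : 0 < alpha <= 1 by rewrite a0 ltW.
have [net hnet] := choice (fun S : {set 'I_N} => exists_net S ha1 hr).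
pose supports := enum [set S : {set 'I_N} | #|S| == k]%SET.
exists (flatten [seq net J | J <- supports]); split.
- pose B : R := Cnet alpha ^+ k * (3 / delta) `^ (k%:R / p).
  have B0 : 0 <= B.
    rewrite mulr_ge0 ?powR_ge0// exprn_ge0//.
    by apply: le_trans (Cnet_ge ha); exact: powR_ge0.
  have rB : ((3 / r) `^ alpha^-1) ^+ k <= B.
    have -> : (3 / r) `^ alpha^-1 = 3 `^ alpha^-1 * (3 / delta) `^ p^-1.
      have -> : r^-1 = ((3 / delta) `^ p^-1) `^ alpha.
        rewrite -invf_div powR_invr ?divr_ge0 ?(ltW d0)// powR_invr ?powR_ge0//.
        by rewrite -powRrM [p^-1 * _]mulrC.
      rewrite powRM// ?powR_ge0// powRKV ?gt_eqF//; exact: powR_ge0.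
    rewrite exprMn /B mulrC [k%:R / p]mulrC powRrM powR_mulrn ?powR_ge0// mulrC.
    apply: ler_wpM2r; first by rewrite exprn_ge0 ?powR_ge0.
    by rewrite lerXn2r ?nnegrE ?powR_ge0 ?(le_trans _ (Cnet_ge ha)) ?powR_ge0 ?Cnet_ge.
  have sizeE : (size (flatten [seq net J | J <- supports]))%:R
      = \sum_(J <- supports) (size (net J))%:R :> R.
    elim: supports => [|S l ih] /=; first by rewrite big_nil.
    by rewrite size_cat natrD ih big_cons.
  rewrite sizeE; apply: (@le_trans _ _ (\sum_(J <- supports) B)).
    rewrite big_seq [leRHS]big_seq; apply: ler_sum => S.
    rewrite mem_enum inE => /eqP Sk; apply: le_trans rB.
    by have [+ _ _] := hnet S; rewrite Sk.
  rewrite big_const_seq count_predT iter_addr_0 -cardE card_draws card_ord.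
  by rewrite -[B *+ _]mulr_natl ler_wpM2r// bin_le_expR.
- move=> y /flatten_mapP[S _ yS]; have [_ h _] := hnet S.
  by have [] := h y yS.
- move=> S Sk x hx; have [_ h1 h2] := hnet S; have [y yS xy] := h2 x hx.
  exists y => //; split; last by have [] := h1 y yS.
  by apply/flatten_mapP; exists S => //; rewrite mem_enum inE Sk.
Qed.

Lemma empirical_moment_concentration (d : measure_display)
    (T : measurableType d) (R : realType) (P : probability T R) (M N : nat)
    (omega : 'I_M * 'I_N -> {RV P >-> R}) (y : 'cV[R]_N)
    (alpha p gamma C Ccon ccon eps : R) (M0 : R -> R) :
  (0 < M)%N -> 0 < gamma -> stable_moment_constant alpha p C ->
  concentration_property alpha p gamma Ccon ccon M0 ->
  iid_sym_stable alpha gamma (row_sum omega y) -> 0 < eps -> M0 eps < M%:R ->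
  (P [set w | (eps < `|empirical_moment omega p w y - C * gamma `^ p|)%R]
    <= (Ccon * M%:R `^ (- ccon))%:E)%E.
Proof.
case: M omega => // n omega _ gamma0 [_ hmoment] hcon iid eps0 hM0.
have [_ /(_ _ _ P n (row_sum omega y) hM0 iid)] := hcon _ eps0.
rewrite (hmoment _ _ P _ gamma)//; last exact: iid.2.
apply: le_trans; rewrite le_eqVlt; apply/orP; left; apply/eqP; congr (P _).
apply/funext => w /=; congr (is_true (_ < `|_ * _ - _|)).
by apply: eq_bigr => i _; rewrite row_sumE.
Qed.

Theorem theorem3p1 (R : realType)
  (alpha gamma p : R) (M N k : nat) (delta eta : R)
  (Calphap Ccon c0 : R) (M0 : R -> R)
  (d : measure_display) (T : measurableType d) (P : probability T R)
  (omega : 'I_M * 'I_N -> {RV P >-> R})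
  (halpha : 0 < alpha < 1) (hgamma : 0 < gamma) (hp : 0 < p < alpha)
  (hM : (1 <= M)%N) (hN : (1 <= N)%N) (hk : (1 <= k <= N)%N)
  (hdelta : 0 < delta < 1) (heta : 0 < eta < 1)
  (homega : iid_sym_stable alpha gamma omega)
  (hC : stable_moment_constant alpha p Calphap)
  (hc0 : 0 < c0 < 2^-1)
  (hcon : concentration_property alpha p gamma Ccon (c0 * (alpha / p - 1)) M0)
  (* the concentration inequality is available for samples of size M at the
     deviation level delta/3 * E|X_1|^p *)
  (hM0 : M0 (delta / 3 * (Calphap * gamma `^ p)) < M%:R)
  (hMlarge :
    (2 * Ccon / eta * Cnet alpha ^+ k * (3 / delta) `^ (k%:R / p)
       * (expR 1 * N%:R / k%:R) ^+ k) `^ (c0 * (alpha / p - 1))^-1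
    <= M%:R) :
  let E : set T :=
    [set w | RQIP_with alpha gamma p Calphap delta k
               (\matrix_(i < M, j < N) omega (i, j) w)] in
  measurable E /\ ((1 - eta)%:E <= P E)%E.
Proof.
move=> E.
have /andP[a0 a1] := halpha; have /andP[p0 pa] := hp.
have /andP[d0 d1] := hdelta; have /andP[e0 e1] := heta.
have /andP[c00 c01] := hc0; have /andP[k0 kN] := hk; have [C0 hmoment] := hC.
have mE : measurable E.
  apply: measurable_RQIP => //;
    by rewrite ?(ltW a1) ?(ltW hgamma) ?(ltW C0) ?(ltW d0) ?(ltW d1).
split=> //.
pose A := Calphap * gamma `^ p.
have A0 : 0 < A by rewrite mulr_gt0 ?powR_gt0.
pose eps := delta / 3 * A.
have eps0 : 0 < eps by rewrite mulr_gt0// divr_gt0.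
pose ccon := c0 * (alpha / p - 1).
have ccon0 : 0 < ccon by rewrite mulr_gt0// subr_gt0 ltr_pdivlMr// mul1r.
have [L [sizeL sphereL netL]] := net_points N halpha hp hdelta k0.
pose bad y : set T := [set w | eps < `|empirical_moment omega p w y - A|].
have hbad y : y \in L -> measurable (bad y) /\
    (P (bad y) <= (Ccon * M%:R `^ (- ccon))%:E)%E.
  move=> yL; split.
    rewrite (_ : bad y = (fun w => `|empirical_moment omega p w y - A|)
                           @^-1` `]eps, +oo[).
      rewrite -[_ @^-1` _]setTI.
      have mf : measurable_fun setT (fun w => `|empirical_moment omega p w y - A|).
        apply: measurableT_comp => //; apply: measurable_funB => //.
        exact: measurable_empirical_moment.
      exact: mf.
    by apply/seteqP; split=> w; rewrite /bad/= in_itv/= andbT.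
  have iid := iid_row_sum hN homega (sphereL y yL).
  exact: (empirical_moment_concentration hM hgamma hC hcon iid eps0 hM0).
have [mBad PBad] := union_bound hbad.
set Bad := [set w | exists2 i, i \in L & bad i w] in mBad PBad.
have BadE : ~` Bad `<=` E.
  move=> w notbad x xk; have [S Sk xS] := sparse_supported kN xk.
  have hf : pseminorm p (empirical_moment omega p w).
    by apply: empirical_moment_pseminorm; rewrite p0 ltW// (lt_trans pa).
  have close y : y \in L /\ supported S y ->
      supported S y /\ `|empirical_moment omega p w y - A| <= delta / 3 * A.
    move=> [yL yS]; split=> //; rewrite leNgt; apply/negP => h.
    by apply: notbad; exists y.
  pose LS := [seq y <- L | `[< supported S y >]].
  have LSclose y : y \in LS ->
      supported S y /\ `|empirical_moment omega p w y - A| <= delta / 3 * A.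
    by rewrite mem_filter => /andP[/asboolP yS yL]; exact: close.
  have LSnet z : sphere alpha S z -> exists2 y, y \in LS &
      power_sum alpha (z - y) <= (delta / 3) `^ (alpha / p).
    move=> hz; have [y [yL yS] zy] := netL S Sk z hz.
    by exists y => //; rewrite mem_filter yL andbT; apply/asboolP.
  have := net_concentration hp (ltW a1) hdelta (ltW A0) hf LSclose LSnet xS.
  by rewrite powRM ?powR_ge0 ?(ltW hgamma)// /A !mulrA.
have numeric : (size L)%:R * (Ccon * M%:R `^ (- ccon)) <= eta.
  have Mp : 0 < M%:R `^ ccon :> R by rewrite powR_gt0// ltr0n.
  case EL : L => [|y L']; first by rewrite mul0r ltW.
  have Ccon0 : 0 <= Ccon.
    have /hbad[_] : y \in L by rewrite EL mem_head.
    move=> /(le_trans (measure_ge0 _ _)); rewrite lee_fin pmulr_lge0//.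
    by rewrite powRN invr_gt0.
  rewrite -EL powRN mulrA ler_pdivrMr//.
  set Q := (X in X `^ _ <= _) in hMlarge.
  pose K : R := (expR 1 * N%:R / k%:R) ^+ k
    * (Cnet alpha ^+ k * (3 / delta) `^ (k%:R / p)).
  have QE : eta * Q = 2 * (Ccon * K).
    by rewrite /Q /K; field; rewrite !gt_eqF// ltr0n.
  have K0 : 0 <= K by apply: le_trans sizeL.
  have Q0 : 0 <= Q by rewrite -(pmulr_rge0 _ e0) QE mulr_ge0// mulr_ge0.
  have QM : Q <= M%:R `^ ccon.
    rewrite -[leLHS](@powRVK _ ccon) ?gt_eqF//.
    by apply: le_powR hMlarge; rewrite ?powR_ge0 ?(ltW ccon0).
  apply: (@le_trans _ _ (eta * Q)); last by rewrite ler_pM2l.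
  rewrite QE; have : (size L)%:R * Ccon <= K * Ccon by rewrite ler_wpM2r.
  have : 0 <= K * Ccon by rewrite mulr_ge0.
  lra.
apply: (@le_trans _ _ (P (~` Bad))); last first.
  by apply: le_measure; rewrite ?inE//; exact: measurableC.
rewrite probability_setC// EFinB leeB//.
by apply: le_trans PBad _; rewrite lee_fin.
Qed.
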